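(* Let $\{\mathbf e_j\}_{j=1}^\infty$ be a normalized quasi-greedy basis in a (real or complex) Banach space $\mathbb X$. Then there exists $c>0$ such that for all $N,k=1,2,\ldots$ $$\big\|x-G_{N+k}(x)\big\|\,\le\, c\,\Big(1+\frac{h_r(N)}{h_l(k)}\Big)\,\sigma_N(x),\qquad\forall\,x\in\mathbb X$$ (for any choice of greedy ordering defining $G_{N+k}(x)$).
   Context: $\mathbb X$ is a real or complex Banach space with norm $\|\cdot\|$, and $\{\mathbf e_j\}_{j=1}^\infty$ is a countable (Schauder) basis, normalized: $\|\mathbf e_j\|=1$ for all $j$. Each $x\in\mathbb X$ has a unique expansion $x=\sum_{j=1}^\infty a_j(x)\mathbf e_j$. Greedy algorithm: a greedy ordering for $x$ is an injective map $\pi:\mathbb N\to\mathbb N$ whose range contains $\{j: a_j(x)\ne0\}$ and such that $|a_{\pi(k)}(x)|\ge|a_{\pi(k+1)}(x)|$ for all $k\in\mathbb N$. Given such $\pi$, $G_N(x)=G_N^\pi(x)=\sum_{k=1}^N a_{\pi(k)}(x)\mathbf e_{\pi(k)}$. The basis is quasi-greedy if $G_N(x)\to x$ as $N\to\infty$ for all $x\in\mathbb X$; this is known to be equivalent to the existence of a constant $\widetilde K$ such that $\|G_N^\pi(x)\|\le \widetilde K\|x\|$ for all $x\in\mathbb X$, all $N\ge 1$ and all greedy orderings $\pi$ for $x$. $\Sigma_N$ is the set of all $y\in\mathbb X$ with at most $N$ nonzero coefficients in the basis expansion, and $\sigma_N(x)=\inf_{y\in\Sigma_N}\|x-y\|$.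 $h_l(n)=\inf_{|A|=n}\|\sum_{j\in A}\mathbf e_j\|$ and $h_r(n)=\sup_{|A|=n}\|\sum_{j\in A}\mathbf e_j\|$ (over $A\subset\mathbb N$). *)

(* Defs.v *)
From HB Require Import structures.
From mathcomp Require Import all_boot all_order all_algebra.
From mathcomp Require Import finmap.
From mathcomp Require Import complex.
From mathcomp Require Import all_classical all_reals all_analysis.

Set Implicit Arguments.
Unset Strict Implicit.
Unset Printing Implicit Defensive.

Import Order.TTheory GRing.Theory Num.Theory.
Import numFieldNormedType.Exports.

Local Open Scope classical_set_scope.
Local Open Scope ring_scope.

Inductive scalar_kind := RealScalars | ComplexScalars.

Definition scalars (R : realType) (s : scalar_kind) : numFieldType :=
  match s with
  | RealScalars => R : numFieldType
  | ComplexScalars => (complex R) : numFieldType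
  end.

Definition scalar_re (R : realType) (s : scalar_kind) : scalars R s -> R :=
  match s with
  | RealScalars => fun a : R => a
  | ComplexScalars => fun a : complex R => complex.Re a
  end.

Section Bases.
Context (R : realType) (s : scalar_kind).
Context (X : completeNormedModType (scalars R s)).
Implicit Types (e : nat -> X) (x y : X) (pi : nat -> nat).

(* The library norm takes its values in the scalar field. In the complex case
   it is a nonnegative element of [complex R]; this is the same norm in [R]. *)
Definition rnorm x : R := scalar_re `|x|.

Definition expansion e x (a : nat -> scalars R s) : Prop :=
  (fun n => \sum_(0 <= j < n) a j *: e j) @ \oo --> x.

Definition schauder_basis e : Prop := forall x, exists! a, expansion e x a.

Definition coef e x : nat -> scalars R s :=
  xget (fun=> 0) [set a | expansion e x a].

Definition greedy_ordering e x pi : Prop :=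
  [/\ injective pi,
      [set j | coef e x j != 0] `<=` range pi
    & forall k, `|coef e x (pi k.+1)| <= `|coef e x (pi k)|].

Definition greedy_sum e x pi (N : nat) : X :=
  \sum_(0 <= k < N) coef e x (pi k) *: e (pi k).

(* Ties between coefficients of equal modulus may be broken arbitrarily, so
   convergence is required for every greedy ordering. *)
Definition quasi_greedy e : Prop :=
  forall x pi, greedy_ordering e x pi -> greedy_sum e x pi @ \oo --> x.

Definition Sigma e (N : nat) : set X :=
  [set y | ([set j | coef e y j != 0%R] #<= `I_N)%card].

Definition sigma e (N : nat) x : R :=
  inf [set rnorm (x - y) | y in Sigma e N].

(* [inf] and [sup] in [R] are 0 by convention on sets that are empty or
   unbounded. For a normalized basis this never happens: the norms below lie
   between 0 and [n], and [Sigma e N] contains 0. *)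
Definition indicator_norms e (n : nat) : set R :=
  [set rnorm (\sum_(j <- A) e j) | A in [set A : {fset nat} | #|` A| = n]].

Definition h_l e (n : nat) : R := inf (indicator_norms e n).

Definition h_r e (n : nat) : R := sup (indicator_norms e n).

End Bases.

(* Main.v *)
Require Import Defs.
From HB Require Import structures.
From mathcomp Require Import all_boot all_order all_algebra.
From mathcomp Require Import finmap.
From mathcomp Require Import complex.
From mathcomp Require Import ring lra.
From mathcomp Require Import all_classical all_reals all_analysis.

Set Implicit Arguments.
Unset Strict Implicit.
Unset Printing Implicit Defensive.

Import Order.TTheory GRing.Theory Num.Theory.
Import numFieldNormedType.Exports.

Local Open Scope classical_set_scope.
Local Open Scope ring_scope.

(** Let L be the set of the first N + k indices of the greedy ordering of x,
    let y have its coefficients supported in a set B of at most N indices, and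
    put z = x - y. Outside B the vectors x and z have the same coefficients, so
    if alpha is the least modulus of a coefficient of x on L, then the set
    G = (L \ B) + {j in B : |z_j| >= alpha} is greedy for z: the moduli of the
    coefficients of z are at least alpha on G and at most alpha off G. Comparing
    coefficients, with P_A the coordinate projection onto A,
      x - P_L x = z - P_G z - P_(B \ G) z + P_(B \ L) x.
    The uniform bound K on greedy projections controls P_G z by K |z|. Each of
    the last two terms has at most N coefficients, all of modulus at most alpha,
    and such a vector has norm at most 4 K alpha h_r(N) ([rnorm_le_h_r]). Finally
    |G| >= k because |L| = N + k and |B| <= N, and a greedy set of size at least k
    on which z has coefficients of modulus at least alpha forces
    alpha h_l(k) <= 8 K^2 |z| ([h_l_le_of_greedy_set]). Adding up gives
    [greedy_error_le], and the infimum over y gives the theorem.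

    The two democracy estimates use that subsets of a set on which the
    coefficients have constant modulus are greedy. Hence all subset sums of such
    a vector are bounded by K times its norm, and by convexity so are, up to the
    factor 4, all sums with bounded scalar weights ([rnorm_flat_weights_le]).
    Flattening the coefficients of z on a greedy set to the constant modulus
    alpha costs a factor 2 K: the weights alpha / |z_j| are monotone along the
    greedy order, so summation by parts applies ([rnorm_truncation_le]).

    Two uniform bounds have to be extracted from hypotheses that are only
    pointwise. The coefficient functionals are continuous: the supremum of the
    norms of the partial sums is a countably subadditive seminorm, and such a
    seminorm on a Banach space is bounded ([zabreiko], a form of Baire's
    theorem). The greedy projections are bounded by a common constant K
    ([greedy_cproj_uniformly_bounded]) by a gliding hump: otherwise there are
    finitely supported vectors of rapidly decreasing norm, with disjoint supports,
    each having a greedy projection of norm 1. Their sum has a greedy ordering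
    that runs through the supports one after the other, and along it the greedy
    sums are not Cauchy. *)

(** * Real and complex scalars *)

Definition of_real (R : realType) (s : scalar_kind) : R -> scalars R s :=
  match s with
  | RealScalars => fun r : R => r
  | ComplexScalars => fun r : R => (r%:C)%C
  end.

Section Scalars.
Context (R : realType) (s : scalar_kind).
Implicit Types (a b : scalars R s) (r t : R).

Definition modulus a : R := scalar_re `|a|.

Fact of_real_is_zmod_morphism : zmod_morphism (@of_real R s).
Proof. by case: s => //= x y; rewrite rmorphB. Qed.

Fact of_real_is_monoid_morphism : monoid_morphism (@of_real R s).
Proof. by case: s => /=; split => //= x y; rewrite rmorphM. Qed.

HB.instance Definition _ :=
  GRing.isZmodMorphism.Build R (scalars R s) (@of_real R s)
    of_real_is_zmod_morphism.
HB.instance Definition _ :=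
  GRing.isMonoidMorphism.Build R (scalars R s) (@of_real R s)
    of_real_is_monoid_morphism.

Lemma ler_of_real r t : (of_real s r <= of_real s t) = (r <= t).
Proof. by case: s => //=; rewrite lecR. Qed.

Lemma ltr_of_real r t : (of_real s r < of_real s t) = (r < t).
Proof. by case: s => //=; rewrite ltcR. Qed.

Lemma of_realK r : scalar_re (of_real s r) = r.
Proof. by case: s. Qed.

Lemma scalar_reK a : 0 <= a -> of_real s (scalar_re a) = a.
Proof.
case: s a => //= -[x y]; rewrite lecE /= => /andP[/eqP -> _] //.
Qed.

Lemma norm_of_real r : `|of_real s r| = of_real s `|r|.
Proof.
case: s => //=.
by rewrite normc_def /= expr0n addr0 sqrtr_sqr.
Qed.

Lemma modulusE a : of_real s (modulus a) = `|a|.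
Proof. by rewrite scalar_reK. Qed.

Lemma of_real_inj r t : of_real s r = of_real s t -> r = t.
Proof. exact: fmorph_inj. Qed.

Lemma modulus_of_real r : modulus (of_real s r) = `|r|.
Proof. by rewrite /modulus norm_of_real of_realK. Qed.

Lemma le_modulus a b : (modulus a <= modulus b) = (`|a| <= `|b|).
Proof. by rewrite -ler_of_real !modulusE. Qed.

Lemma modulus_ge0 a : 0 <= modulus a.
Proof. by rewrite -ler_of_real modulusE rmorph0. Qed.

Lemma modulus_eq0 a : (modulus a == 0) = (a == 0).
Proof. by rewrite -(inj_eq (@of_real_inj)) modulusE rmorph0 normr_eq0. Qed.

Lemma modulusM a b : modulus (a * b) = modulus a * modulus b.
Proof. by apply: of_real_inj; rewrite rmorphM /= !modulusE normrM. Qed.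

Lemma modulusV a : modulus a^-1 = (modulus a)^-1.
Proof. by apply: of_real_inj; rewrite fmorphV /= !modulusE normfV. Qed.

Lemma modulusD a b : modulus (a + b) <= modulus a + modulus b.
Proof. by rewrite -ler_of_real rmorphD /= !modulusE ler_normD. Qed.

Lemma modulus1 : modulus 1 = 1.
Proof. by rewrite /modulus normr1 -(rmorph1 (@of_real R s)) of_realK. Qed.

Lemma modulus0 : modulus 0 = 0.
Proof. by apply/eqP; rewrite modulus_eq0. Qed.

End Scalars.

(** The only structure of the scalar field that the convexity and completeness
    arguments below use: one statement covers both kinds of scalars, with the
    unit [i] equal to 0 in the real case. *)
Lemma scalar_parts (R : realType) (s : scalar_kind) :
  exists (i : scalars R s) (re im : scalars R s -> R),
  [/\ modulus i <= 1,
      (forall a, a = of_real s (re a) + i * of_real s (im a)),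
      (forall a b, re (a - b) = re a - re b /\ im (a - b) = im a - im b)
    & (forall a, `|re a| <= modulus a /\ `|im a| <= modulus a)].
Proof.
case: s.
  exists (0 : scalars R RealScalars), (fun a => a), (fun=> 0); split.
  - by rewrite modulus0 ler01.
  - by move=> a; rewrite mulr0 addr0.
  - by move=> a b /=; rewrite subr0.
  - move=> a; rewrite normr0; split; last exact: modulus_ge0.
    by rewrite /modulus.
exists ('i%C : scalars R ComplexScalars), (@complex.Re R),
  (@complex.Im R); split.
- by rewrite /modulus normc_def /= expr0n add0r expr1n sqrtr1.
- by move=> [x y] /=; simpc.
- by move=> [x y] [x' y'].
- move=> [x y]; rewrite /modulus normc_def /=.
  by rewrite -!sqrtr_sqr !ler_sqrt ?addr_ge0 ?sqr_ge0 // lerDl lerDr !sqr_ge0.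
Qed.

(** * Norms and completeness in real terms *)

Section RealNorm.
Context (R : realType) (s : scalar_kind) (X : completeNormedModType (scalars R s)).
Implicit Types (x y : X) (a : scalars R s) (u : nat -> X).

Lemma rnormE x : of_real s (rnorm x) = `|x|.
Proof. by rewrite scalar_reK. Qed.

Lemma rnorm_ge0 x : 0 <= rnorm x.
Proof. by rewrite -(ler_of_real s) rnormE rmorph0. Qed.

Lemma rnorm_eq0 x : (rnorm x == 0) = (x == 0).
Proof.
rewrite -[RHS]normr_eq0 -rnormE; apply/eqP/eqP => [->|]; first by rewrite rmorph0.
by move=> h; apply: (@of_real_inj _ s); rewrite h rmorph0.
Qed.

Lemma rnorm0 : rnorm (0 : X) = 0.
Proof. by apply/eqP; rewrite rnorm_eq0. Qed.

Lemma rnormD x y : rnorm (x + y) <= rnorm x + rnorm y.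
Proof. by rewrite -(ler_of_real s) rmorphD /= !rnormE ler_normD. Qed.

Lemma rnormN x : rnorm (- x) = rnorm x.
Proof. by rewrite /rnorm normrN. Qed.

Lemma rnorm_sub_le x y : rnorm (x - y) <= rnorm x + rnorm y.
Proof. by rewrite -(rnormN y) rnormD. Qed.

Lemma rnorm_distC x y : rnorm (x - y) = rnorm (y - x).
Proof. by rewrite -rnormN opprB. Qed.

Lemma rnormZ a x : rnorm (a *: x) = modulus a * rnorm x.
Proof.
by apply: (@of_real_inj _ s); rewrite rmorphM /= !rnormE modulusE normrZ.
Qed.

Lemma rnormZ_real (r : R) x : rnorm (of_real s r *: x) = `|r| * rnorm x.
Proof. by rewrite rnormZ modulus_of_real. Qed.

Lemma rnorm_sum (I : Type) (r : seq I) (P : pred I) (F : I -> X) :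
  rnorm (\sum_(i <- r | P i) F i) <= \sum_(i <- r | P i) rnorm (F i).
Proof.
elim/big_ind2 : _ => // [|x a y b xa yb]; first by rewrite rnorm0.
exact: le_trans (rnormD _ _) (lerD xa yb).
Qed.

Lemma cvg_rnormP u x :
  u @ \oo --> x <->
  forall eps : R, 0 < eps -> \forall n \near \oo, rnorm (x - u n) < eps.
Proof.
split=> [/cvgrPdist_lt ux eps eps0|ux].
  have /ux : 0 < of_real s eps by rewrite -(rmorph0 (@of_real R s)) ltr_of_real.
  by apply: filterS => n; rewrite -rnormE ltr_of_real.
apply/cvgrPdist_lt => eps eps0.
have := ux (scalar_re eps); rewrite -(ltr_of_real s) rmorph0 scalar_reK ?ltW //.
move=> /(_ eps0); apply: filterS => n.
by rewrite -(ltr_of_real s) rnormE scalar_reK // ltW.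
Qed.

Lemma rnorm_complete u :
  (forall eps : R, 0 < eps ->
     exists n0, forall n, (n0 <= n)%N -> rnorm (u n0 - u n) < eps) ->
  exists x, u @ \oo --> x.
Proof.
move=> uC; suff /cauchy_cvgP /cvg_ex[x ux] : cauchy (u @ \oo) by exists x.
apply: cauchy_exP => eps eps0.
have := uC (scalar_re eps); rewrite -(ltr_of_real s) rmorph0 scalar_reK ?ltW //.
move=> /(_ eps0)[n0 un0]; exists (u n0), n0 => //= n /un0.
by rewrite -(ltr_of_real s) rnormE scalar_reK ?ltW // -ball_normE.
Qed.

End RealNorm.

Lemma real_complete (R : realType) (u : nat -> R) :
  (forall eps : R, 0 < eps ->
     exists n0, forall n, (n0 <= n)%N -> `|u n0 - u n| < eps) ->
  exists l : R, u @ \oo --> l.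
Proof.
move=> uC; suff /cauchy_cvgP /cvg_ex[x ux] : cauchy (u @ \oo) by exists x.
apply: cauchy_exP => eps /uC[n0 un0].
by exists (u n0), n0 => //= n /un0; rewrite -ball_normE.
Qed.

Lemma scalars_complete (R : realType) (s : scalar_kind) (a : nat -> scalars R s) :
  (forall eps : R, 0 < eps ->
     exists n0, forall n, (n0 <= n)%N -> modulus (a n0 - a n) < eps) ->
  exists l, forall eps : R, 0 < eps ->
    \forall n \near \oo, modulus (l - a n) < eps.
Proof.
have [i [re [im [i1 reimE reimB reim_le]]]] := scalar_parts R s.
move=> aC.
have [p /cvgrPdist_lt ap] : exists p : R, re \o a @ \oo --> p.
  apply: real_complete => eps /aC[n0 an0]; exists n0 => n /an0.
  by apply: le_lt_trans; rewrite /= -(reimB _ _).1; apply: (reim_le _).1.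
have [q /cvgrPdist_lt aq] : exists q : R, im \o a @ \oo --> q.
  apply: real_complete => eps /aC[n0 an0]; exists n0 => n /an0.
  by apply: le_lt_trans; rewrite /= -(reimB _ _).2; apply: (reim_le _).2.
exists (of_real s p + i * of_real s q) => eps eps0.
near=> n.
rewrite {1}(reimE (a n)) opprD addrACA -mulrBr -!rmorphB /=.
apply: le_lt_trans (modulusD _ _) _.
rewrite modulusM !modulus_of_real (splitr eps).
apply: ltr_leD; first by near: n; apply: ap; rewrite divr_gt0.
apply: le_trans (ler_piMl _ i1) _ => //.
by apply: ltW; near: n; apply: aq; rewrite divr_gt0.
Unshelve. all: by end_near. Qed.

(** * Geometric estimates *)

Lemma halves_sum_le (R : realType) (n : nat) :
  \sum_(0 <= k < n) (2^-1 : R) ^+ k <= 2.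
Proof.
suff -> : \sum_(0 <= k < n) (2^-1 : R) ^+ k = 2 - 2 * 2^-1 ^+ n.
  by rewrite gerBl mulr_ge0 ?exprn_ge0 ?invr_ge0.
elim: n => [|n IH]; first by rewrite big_geq // expr0 mulr1 subrr.
by rewrite big_nat_recr //= IH exprS; field.
Qed.

Lemma near_half_expn_lt (R : realType) (eps : R) :
  0 < eps -> \forall n \near \oo, (2^-1 : R) ^+ n < eps.
Proof.
move=> eps0.
have /cvgrPdist_lt /(_ _ eps0) : (fun n => (2^-1 : R) ^+ n) @ \oo --> 0.
  by apply: cvg_expr; rewrite ger0_norm ?invf_lt1 ?ltr1n.
apply: filterS => n; rewrite sub0r normrN ger0_norm //.
Qed.

Lemma halves_tail_sum_le (R : realType) (m n : nat) :
  \sum_(m <= k < n) (2^-1 : R) ^+ k <= 2 * 2^-1 ^+ m.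
Proof.
rewrite -{1}[m]add0n big_addn.
under eq_bigr do rewrite exprD.
by rewrite -mulr_suml ler_wpM2r ?exprn_ge0 ?invr_ge0 // halves_sum_le.
Qed.

Lemma geometric_cvg (R : realType) (s : scalar_kind)
    (X : completeNormedModType (scalars R s)) (u : nat -> X) :
  (forall k, rnorm (u k.+1 - u k) <= 2^-1 ^+ k) -> exists x : X, u @ \oo --> x.
Proof.
move=> uS; apply: rnorm_complete => eps eps0.
have [n _ hn] := near_half_expn_lt (divr_gt0 eps0 (ltr0n R 2)).
exists n => m nm; have := hn n (leqnn n); rewrite ltr_pdivlMr // mulrC.
apply: le_lt_trans; apply: le_trans (halves_tail_sum_le R n m).
rewrite rnorm_distC -telescope_sumr //.
by apply: le_trans (rnorm_sum _ _ _) (ler_sum _ _) => k _.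
Qed.

(** * Countably subadditive seminorms are bounded *)

Section Zabreiko.
Context (R : realType) (s : scalar_kind) (X : completeNormedModType (scalars R s)).
Variable p : X -> R.
Hypothesis pB : forall x y, p (x - y) <= p x + p y.
Hypothesis pZ : forall (r : R) x, 0 <= r -> p (of_real s r *: x) <= r * p x.

(** Baire's argument. If every sublevel set missed a ball inside every ball, a
    nested sequence of balls, the n-th missing the points where p <= n, would
    shrink to a point where p exceeds every integer. *)
Lemma seminorm_sublevel_dense_in_ball :
  exists (C : nat) (x0 : X) (r : R), 0 < r /\
    forall y, rnorm (y - x0) < r ->
    forall eps, 0 < eps -> exists q, rnorm (y - q) < eps /\ p q <= C%:R.
Proof.
apply: contrapT => nodense.
have escape (C : nat) x0 r : 0 < r -> exists y (eps : R),
    [/\ rnorm (y - x0) < r, 0 < eps &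
        forall q, p q <= C%:R -> eps <= rnorm (y - q)].
  move=> r0; apply: contrapT => noy; apply: nodense; exists C, x0, r.
  split=> // y yr eps eps0; apply: contrapT => noq; apply: noy.
  exists y, eps; split=> // q qC; rewrite leNgt; apply/negP => yq.
  by apply: noq; exists q.
have step (t : nat * (X * R)) : exists t' : X * R, 0 < t.2.2 ->
    [/\ 0 < t'.2, t'.2 <= 2^-1 ^+ t.1,
        rnorm (t'.1 - t.2.1) + t'.2 <= t.2.2 &
        forall q, p q <= t.1%:R -> t'.2 + t'.2 <= rnorm (t'.1 - q)].
  case: t => C [x0 r] /=; have [r0|_] := boolP (0 < r); last by exists (0, 0).
  have [y [eps [yr eps0 yC]]] := escape C x0 r r0.
  have d0 : 0 < r - rnorm (y - x0) by rewrite subr_gt0.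
  have h0 : 0 < (2^-1 : R) ^+ C by rewrite exprn_gt0 ?invr_gt0.
  (* The new ball of radius [r'] lies in the old one, and so that its closure
     also misses the sublevel set, twice [r'] is at most [eps]. *)
  pose r' := Num.min (eps / 2) (Num.min (r - rnorm (y - x0)) (2^-1 ^+ C)).
  exists (y, r') => _ /=; split.
  - by rewrite !lt_min d0 h0 divr_gt0.
  - by rewrite !ge_min lexx !orbT.
  - by rewrite addrC -lerBrDr !ge_min lexx !orbT.
  - move=> q /yC; apply: le_trans; rewrite (splitr eps).
    by rewrite lerD // !ge_min lexx.
have [F FP] := choice step.
pose B := fix B n : X * R := if n is m.+1 then F (m, B m) else (0, 1).
have BP n : 0 < (B n).2 /\ [/\ 0 < (B n.+1).2, (B n.+1).2 <= 2^-1 ^+ n,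
        rnorm ((B n.+1).1 - (B n).1) + (B n.+1).2 <= (B n).2 &
        forall q, p q <= n%:R -> (B n.+1).2 + (B n.+1).2 <= rnorm ((B n.+1).1 - q)].
  elim: n => [|n [_ [IH _ _ _]]].
    by split; [exact: ltr01|apply: (FP (0%N, B 0%N)); exact: ltr01].
  by split=> //; exact: (FP (n.+1, B n.+1)).
have nested n m : (n <= m)%N -> rnorm ((B n).1 - (B m).1) + (B m).2 <= (B n).2.
  elim: m => [|m IH].
    by rewrite leqn0 => /eqP ->; rewrite subrr rnorm0 add0r.
  rewrite leq_eqVlt => /predU1P[->|]; first by rewrite subrr rnorm0 add0r.
  rewrite ltnS => /IH; have [_ [_ _ h _]] := BP m.
  apply: le_trans; rewrite -(subrKA (B m).1).
  apply: le_trans (lerD (rnormD _ _) (lexx _)) _.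
  by rewrite -addrA lerD2l (rnorm_distC (B m).1).
have [x Bx] : exists x : X, (fun n => (B n).1) @ \oo --> x.
  apply: rnorm_complete => eps /near_half_expn_lt[n _ hn].
  exists n.+1 => m nm; apply: le_lt_trans (hn n (leqnn n)).
  have [_ [_ h _ _]] := BP n; apply: le_trans h.
  apply: le_trans (nested _ _ nm); rewrite lerDl ltW //.
  by have [] := BP m.
have inB n : rnorm ((B n).1 - x) <= (B n).2.
  apply/ler_addgt0Pr => eps eps0.
  have /cvg_rnormP /(_ _ eps0)[m _ hm] := Bx.
  pose k := maxn n m.
  rewrite -(subrKA (B k).1); apply: le_trans (rnormD _ _) _.
  apply: lerD; last first.
    by rewrite rnorm_distC ltW // hm //= leq_maxr.
  apply: le_trans (nested n k (leq_maxl _ _)); rewrite lerDl ltW //.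
  by have [] := BP k.
have [n pn] : exists n : nat, p x <= n%:R.
  by exists (Num.truncn (p x)).+1; rewrite ltW // truncnS_gt.
have [_ [h1 _ _ /(_ x pn) h2]] := BP n.
have := le_trans h2 (inB n.+1).
by rewrite gerDl leNgt h1.
Qed.

(** Translating the ball of the previous lemma to the origin: a small vector is
    the difference of two points of the ball, each approximable in the sublevel
    set. Homogeneity then removes the smallness. *)
Lemma seminorm_almost_open : exists D : R, 0 < D /\
  forall x eps, 0 < eps -> exists q, rnorm (x - q) < eps /\ p q <= D * rnorm x.
Proof.
have [C [x0 [r [r0 dense]]]] := seminorm_sublevel_dense_in_ball.
exists (4 * (C%:R + 1) / r); split.
  by rewrite divr_gt0 // mulr_gt0 // ltr_wpDl.
move=> x eps eps0; have [->|xN0] := eqVneq x 0.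
  exists 0; rewrite subrr rnorm0; split=> //.
  by rewrite mulr0; have := pZ 0 (lexx 0); rewrite rmorph0 scale0r mul0r.
have n0 : 0 < rnorm x by rewrite lt_neqAle rnorm_ge0 eq_sym rnorm_eq0 xN0.
pose t := r / (2 * rnorm x).
have t0 : 0 < t by rewrite divr_gt0 // mulr_gt0 //.
have e0 : 0 < t * eps / 2 by rewrite !(mulr_gt0, invr_gt0) //.
have [|q1 [xq1 pq1]] := dense (x0 + of_real s t *: x) _ _ e0.
  rewrite addrC addKr rnormZ_real gtr0_norm // /t.
  have -> : r / (2 * rnorm x) * rnorm x = r / 2 by field; rewrite gt_eqF.
  by rewrite ltr_pdivrMr // mulr_natr mulr2n ltrDl.
have [|q2 [xq2 pq2]] := dense x0 _ _ e0; first by rewrite subrr rnorm0.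
exists (of_real s t^-1 *: (q1 - q2)); split.
  have -> : x - of_real s t^-1 *: (q1 - q2) =
      of_real s t^-1 *: ((x0 + of_real s t *: x - q1) - (x0 - q2)).
    rewrite -[x0 + _ - q1]addrA opprD addrACA subrr add0r opprK -addrA.
    rewrite [- q1 + q2]addrC -[q2 - q1]opprB [RHS]scalerBr scalerA -rmorphM.
    by rewrite mulVf ?gt_eqF // rmorph1 scale1r.
  rewrite rnormZ_real gtr0_norm ?invr_gt0 // ltr_pdivrMl //.
  apply: le_lt_trans (rnorm_sub_le _ _) _.
  by rewrite (splitr (t * eps)) ltrD.
apply: le_trans (pZ _ _) _; first by rewrite invr_ge0 ltW.
apply: (@le_trans _ _ (t^-1 * (C%:R + C%:R))).
  by rewrite ler_pM2l ?invr_gt0 // (le_trans (pB _ _)) // lerD.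
rewrite /t invf_div.
have -> : 2 * rnorm x / r * (C%:R + C%:R) = 4 * C%:R / r * rnorm x.
  by field; rewrite gt_eqF.
by rewrite ler_pM2r // ler_pM2r ?invr_gt0 // ler_pM2l // lerDl.
Qed.

Hypothesis p_series : forall x (v : nat -> X) (M : R),
  (fun n => \sum_(0 <= k < n) v k) @ \oo --> x ->
  (forall k, p (v k) <= M * 2^-1 ^+ k) -> p x <= 2 * M.

(** Successive approximation: approximating x up to |x|/2, then the error up to
    |x|/4 and so on writes x as a series whose terms have geometrically
    decreasing values of p. *)
Lemma zabreiko : exists2 D : R, 0 < D & forall x, p x <= D * rnorm x.
Proof.
have [D [D0 almost]] := seminorm_almost_open.
exists (2 * D); first by rewrite mulr_gt0.
move=> x; have [->|xN0] := eqVneq x 0.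
  rewrite rnorm0 mulr0.
  by have := pZ 0 (lexx 0); rewrite rmorph0 scale0r mul0r.
have n0 : 0 < rnorm x by rewrite lt_neqAle rnorm_ge0 eq_sym rnorm_eq0 xN0.
pose err k : R := rnorm x * 2^-1 ^+ k.
have err0 k : 0 < err k by rewrite mulr_gt0 // exprn_gt0 ?invr_gt0.
have step (t : nat * X) :
    exists q, rnorm (t.2 - q) < err t.1.+1 /\ p q <= D * rnorm t.2.
  exact: almost.
have [f fP] := choice step.
pose res := fix res k := if k is m.+1 then res m - f (m, res m) else x.
have res_le k : rnorm (res k) <= err k.
  case: k => [|k]; first by rewrite /err expr0 mulr1.
  by rewrite ltW //; have [] := fP (k, res k).
rewrite -mulrA; apply: (p_series (v := fun k => f (k, res k))).
  have -> : (fun n => \sum_(0 <= k < n) f (k, res k)) = (fun n => x - res n).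
    apply/funext; elim=> [|n IH]; first by rewrite big_geq //= subrr.
    by rewrite big_nat_recr //= IH opprB addrA addrAC.
  apply/cvg_rnormP => eps eps0; have := near_half_expn_lt (divr_gt0 eps0 n0).
  apply: filterS => n; rewrite ltr_pdivlMr // mulrC => h.
  by rewrite subKr (le_lt_trans (res_le n)).
move=> k; have [_ /le_trans] := fP (k, res k); apply.
by rewrite -mulrA ler_pM2l //=.
Qed.

End Zabreiko.

(** * Continuity of the coefficients *)

Section Coefficients.
Context (R : realType) (s : scalar_kind) (X : completeNormedModType (scalars R s)).
Variable e : nat -> X.
Hypothesis e_basis : schauder_basis e.
Implicit Types (x y : X) (j n : nat) (A : seq nat).

Lemma coef_expansion x : expansion e x (coef e x).
Proof.
have [a [ax _]] := e_basis x.
exact: (@xgetPex _ (fun=> 0) [set a | expansion e x a]) (ex_intro _ a ax).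
Qed.

Arguments coef_expansion : clear implicits.

Lemma expansion_coef x a : expansion e x a -> coef e x = a.
Proof.
have [b [_ b_uniq]] := e_basis x.
by move=> /b_uniq <-; rewrite (b_uniq _ (coef_expansion x)).
Qed.

Lemma basis_coefD x y j : coef e (x + y) j = coef e x j + coef e y j.
Proof.
suff -> : coef e (x + y) = fun j => coef e x j + coef e y j by [].
apply: expansion_coef; rewrite /expansion.
under eq_fun do under eq_bigr do rewrite scalerDl.
under eq_fun do rewrite big_split.
exact: cvgD (coef_expansion x) (coef_expansion y).
Qed.

Lemma basis_coefZ (a : scalars R s) x j : coef e (a *: x) j = a * coef e x j.
Proof.
suff -> : coef e (a *: x) = fun j => a * coef e x j by [].
apply: expansion_coef; rewrite /expansion.
under eq_fun do under eq_bigr do rewrite -scalerA.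
under eq_fun do rewrite -scaler_sumr.
exact: cvgZl_tmp (coef_expansion x).
Qed.

Lemma basis_coefN x j : coef e (- x) j = - coef e x j.
Proof. by rewrite -scaleN1r basis_coefZ mulN1r. Qed.

Lemma basis_coefB x y j : coef e (x - y) j = coef e x j - coef e y j.
Proof. by rewrite basis_coefD basis_coefN. Qed.

Lemma basis_coef0 j : coef e 0 j = 0.
Proof. by rewrite -(scale0r 0) basis_coefZ mul0r. Qed.

Lemma coef_inj x y : coef e x =1 coef e y -> x = y.
Proof.
move=> /funext xy; have := coef_expansion x; rewrite xy => h.
exact: (cvg_unique _ h (coef_expansion y)).
Qed.

Lemma coef_basis i j : coef e (e i) j = (j == i)%:R.
Proof.
suff -> : coef e (e i) = fun j => (j == i)%:R by [].
apply: expansion_coef; apply/cvg_rnormP => eps eps0.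
exists i.+1 => //= n; rewrite /mkset => ilt.
rewrite (bigD1_seq i) ?mem_index_iota ?iota_uniq //= eqxx scale1r.
rewrite big1 ?addr0 ?subrr ?rnorm0 // => k /negPf ->.
by rewrite scale0r.
Qed.

Lemma coef_sum_basis A (c : nat -> scalars R s) j : uniq A ->
  coef e (\sum_(i <- A) c i *: e i) j = if j \in A then c j else 0.
Proof.
elim: A => [|i A IH] /=; first by rewrite big_nil basis_coef0.
move=> /andP[iA /IH {}IH]; rewrite big_cons basis_coefD basis_coefZ coef_basis IH inE.
have [->|_] := eqVneq j i; first by rewrite (negPf iA) mulr1 addr0.
by rewrite mulr0 add0r.
Qed.

Definition psum x n : X := \sum_(0 <= j < n) coef e x j *: e j.

Lemma psumB x y n : psum (x - y) n = psum x n - psum y n.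
Proof.
rewrite /psum -sumrB; apply: eq_bigr => j _.
by rewrite basis_coefB scalerBl.
Qed.

Lemma psumZ a x n : psum (a *: x) n = a *: psum x n.
Proof.
by rewrite /psum scaler_sumr; apply: eq_bigr => j _; rewrite basis_coefZ scalerA.
Qed.

Lemma psum_sum (v : nat -> X) m m' n :
  psum (\sum_(m <= k < m') v k) n = \sum_(m <= k < m') psum (v k) n.
Proof.
apply: (big_morph (fun x => psum x n)) => [x y|].
  by rewrite -{1}[y]opprK psumB -[- y]sub0r psumB !opprB /psum; congr (_ + _);
    rewrite [X in _ - X]big1 ?subr0 // => j _; rewrite basis_coef0 scale0r.
by rewrite /psum big1 // => j _; rewrite basis_coef0 scale0r.
Qed.

Lemma cvg_psum x : psum x @ \oo --> x.
Proof. exact: coef_expansion. Qed.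

Arguments cvg_psum : clear implicits.

Lemma psum_bounded x : exists M : R, forall n, rnorm (psum x n) <= M.
Proof.
have /cvg_rnormP /(_ _ ltr01)[n0 _ xn0] := cvg_psum x.
exists (rnorm x + 1 + \sum_(0 <= n < n0) rnorm (psum x n)) => n.
have [nn0|nn0] := leqP n0 n; last first.
  rewrite (bigD1_seq n) ?mem_index_iota ?iota_uniq //= addrCA lerDl.
  by rewrite !addr_ge0 ?rnorm_ge0 ?sumr_ge0 // => k _; exact: rnorm_ge0.
rewrite ler_wpDr ?sumr_ge0 // => [k _|]; first exact: rnorm_ge0.
have -> : psum x n = x - (x - psum x n) by rewrite subKr.
by apply: le_trans (rnorm_sub_le _ _) _; rewrite lerD2l ltW // xn0.
Qed.

(** The supremum of the norms of the partial sums. It dominates the norm of X,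
    and X is complete for it; the next lemmas turn this into countable
    subadditivity. *)
Definition psum_norm x : R := sup (range (fun n => rnorm (psum x n))).

Lemma ge_psum_norm x n : rnorm (psum x n) <= psum_norm x.
Proof.
apply: sup_upper_bound; last by exists n.
split; first by exists (rnorm (psum x 0)), 0%N.
by have [M xM] := psum_bounded x; exists M => _ [m _ <-].
Qed.

Lemma psum_norm_le x (M : R) :
  (forall n, rnorm (psum x n) <= M) -> psum_norm x <= M.
Proof.
move=> xM; apply: ge_sup; first by exists (rnorm (psum x 0)), 0%N.
by move=> _ [n _ <-].
Qed.

Hypothesis e_normalized : forall j : nat, `|e j| = 1.

Lemma rnorm_basis j : rnorm (e j) = 1.
Proof.
by apply: (@of_real_inj _ s); rewrite rnormE e_normalized rmorph1.
Qed.

Lemma modulus_coef x j :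
  modulus (coef e x j) = rnorm (psum x j.+1 - psum x j).
Proof.
by rewrite /psum big_nat_recr //= addrAC subrr add0r rnormZ rnorm_basis mulr1.
Qed.

(** The series of the v k converges in the stronger norm as well: its partial
    sums have coefficients that converge, and their expansions converge
    uniformly, so the limits are the coefficients of x. Continuity of the
    coefficients for the norm of X is a consequence of this, hence the detour: the
    limits [a] are built first and recognized as the coefficients of x at the end. *)
Lemma psum_norm_series x (v : nat -> X) (M : R) :
  (fun n => \sum_(0 <= k < n) v k) @ \oo --> x ->
  (forall k, psum_norm (v k) <= M * 2^-1 ^+ k) -> psum_norm x <= 2 * M.
Proof.
set u := fun n => _ => ux vM.
have M0 : 0 <= M.
  have := vM 0%N; rewrite mulr1; apply: le_trans.
  exact: le_trans (rnorm_ge0 _) (ge_psum_norm _ 0).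
have tail m m' n : (m <= m')%N ->
    rnorm (psum (u m') n - psum (u m) n) <= 2 * M * 2^-1 ^+ m.
  move=> mm'; rewrite -psumB /u (big_cat_nat (leq0n m) mm') //= addrAC subrr add0r.
  rewrite psum_sum; apply: le_trans (rnorm_sum _ _ _) _.
  apply: (@le_trans _ _ (\sum_(m <= k < m') M * 2^-1 ^+ k)).
    by apply: ler_sum => k _; exact: le_trans (ge_psum_norm _ _) (vM k).
  rewrite -mulr_sumr -mulrA [leRHS]mulrCA ler_wpM2l //.
  exact: halves_tail_sum_le.
have small (eps : R) : 0 < eps -> exists m, 4 * M * 2^-1 ^+ m < eps.
  move=> eps0.
  have [|m _ hm] := near_half_expn_lt (eps := eps / (4 * M + 1)).
    by rewrite divr_gt0 // ltr_wpDl // mulr_ge0.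
  exists m; have := hm m (leqnn m); rewrite ltr_pdivlMr; last first.
    by rewrite ltr_wpDl // mulr_ge0.
  apply: le_lt_trans; rewrite mulrC ler_wpM2l ?lerDl //.
have coef_cvg j : exists l : scalars R s, forall eps : R, 0 < eps ->
    \forall m \near \oo, modulus (l - coef e (u m) j) < eps.
  apply: scalars_complete => eps /small[m hm].
  exists m => m' mm'; rewrite -basis_coefB modulus_coef.
  apply: le_lt_trans (rnorm_sub_le _ _) _; apply: le_lt_trans hm.
  have -> : 4 * M * 2^-1 ^+ m = 2 * M * 2^-1 ^+ m + 2 * M * 2^-1 ^+ m.
    by rewrite -mulrDl; congr (_ * _); ring.
  by rewrite !psumB !(rnorm_distC (psum (u m) _)) lerD // tail.
have [a au] := choice coef_cvg.
pose t n : X := \sum_(0 <= j < n) a j *: e j.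
have t_near n (eps : R) : 0 < eps ->
    \forall m \near \oo, rnorm (t n - psum (u m) n) < eps.
  elim: n eps => [|n IH] eps eps0.
    by apply: nearW => m; rewrite /t /psum !big_geq // subrr rnorm0.
  have h2 : 0 < eps / 2 by rewrite divr_gt0.
  apply: filterS2 (IH _ h2) (au n _ h2) => m h h'.
  rewrite /t /psum !big_nat_recr //= opprD addrACA -scalerBl.
  apply: le_lt_trans (rnormD _ _) _.
  by rewrite rnormZ rnorm_basis mulr1 (splitr eps) ltrD.
have t_tail m n : rnorm (t n - psum (u m) n) <= 2 * M * 2^-1 ^+ m.
  apply/ler_addgt0Pr => eps /(t_near n)[m1 _ hm1].
  rewrite -(subrKA (psum (u (maxn m m1)) n)); apply: le_trans (rnormD _ _) _.
  by rewrite addrC lerD ?tail ?leq_maxl // ltW // hm1 //= leq_maxr.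
(* Three terms: x is close to [u m], which is close to its own partial sums of
   large order, which are close to [t n] uniformly in [n]. *)
have tx : expansion e x a.
  apply/cvg_rnormP => eps eps0.
  have h2 : 0 < eps / 2 by rewrite divr_gt0.
  have h4 : 0 < eps / 2 / 2 by rewrite !divr_gt0.
  have [m1 hm1] := small _ h4.
  have /cvg_rnormP /(_ _ h4)[m2 _ hm2] := ux.
  pose m := maxn m1 m2.
  have /cvg_rnormP /(_ _ h2) := cvg_psum (u m).
  apply: filterS => n hn.
  rewrite -(subrKA (u m)); apply: le_lt_trans (rnormD _ _) _.
  rewrite -(subrKA (psum (u m) n) (u m)).
  have h1 : rnorm (psum (u m) n - t n) < eps / 2 / 2.
    rewrite rnorm_distC; apply: le_lt_trans (t_tail _ _) _.
    apply: le_lt_trans hm1; apply: ler_pM; rewrite ?exprn_ge0 ?invr_ge0 ?mulr_ge0 //.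
      by rewrite ler_wpM2r // ler_nat.
    by rewrite ler_wiXn2l ?invr_ge0 ?invf_le1 ?ler1n ?leq_maxl.
  have := hm2 m (leq_maxr _ _); rewrite -/(u m) => h3.
  have := rnormD (u m - psum (u m) n) (psum (u m) n - t n).
  move: hn h1 h3; move: (rnorm _) (rnorm _) (rnorm _) (rnorm _) => *; lra.
apply: psum_norm_le => n; rewrite /psum (expansion_coef tx).
have := t_tail 0%N n; rewrite expr0 mulr1; congr (_ <= _); congr rnorm.
rewrite -/(t n) /psum big1 ?subr0 // => j _.
by rewrite /u big_geq // basis_coef0 scale0r.
Qed.

Theorem psum_uniformly_bounded :
  exists2 D : R, 0 < D & forall x n, rnorm (psum x n) <= D * rnorm x.
Proof.
have [||D D0 pD] := @zabreiko R s X psum_norm _ _ psum_norm_series.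
- move=> x y; apply: psum_norm_le => n; rewrite psumB.
  by apply: le_trans (rnorm_sub_le _ _) _; rewrite lerD ?ge_psum_norm.
- move=> r x r0; apply: psum_norm_le => n.
  by rewrite psumZ rnormZ_real ger0_norm // ler_wpM2l ?ge_psum_norm.
by exists D => // x n; apply: le_trans (ge_psum_norm _ _) (pD x).
Qed.

Theorem coef_uniformly_bounded :
  exists2 D : R, 0 < D & forall x j, modulus (coef e x j) <= D * rnorm x.
Proof.
have [D D0 xD] := psum_uniformly_bounded.
exists (D + D); first by rewrite addr_gt0.
move=> x j; rewrite modulus_coef mulrDl.
by apply: le_trans (rnorm_sub_le _ _) _; rewrite lerD.
Qed.

End Coefficients.

Arguments coef_expansion {R s X e} e_basis x.
Arguments cvg_psum {R s X e} e_basis x.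

(** * Greedy sets and humps *)

Section Greedy.
Context (R : realType) (s : scalar_kind) (X : completeNormedModType (scalars R s)).
Variable e : nat -> X.
Hypothesis e_basis : schauder_basis e.
Hypothesis e_normalized : forall j : nat, `|e j| = 1.
Implicit Types (x y z : X) (i j n : nat) (A B L : seq nat).

Let coefE := (basis_coefB e_basis, basis_coefD e_basis, basis_coefZ e_basis).

Definition cproj A x : X := \sum_(j <- A) coef e x j *: e j.

Lemma coef_cproj A x j : uniq A ->
  coef e (cproj A x) j = if j \in A then coef e x j else 0.
Proof. by move=> uA; rewrite /cproj (coef_sum_basis e_basis). Qed.

Lemma cproj_cat A B x : cproj (A ++ B) x = cproj A x + cproj B x.
Proof. by rewrite /cproj big_cat. Qed.

Lemma perm_cproj A B x : perm_eq A B -> cproj A x = cproj B x.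
Proof. exact: perm_big. Qed.

Lemma eq_cproj A x y : {in A, coef e x =1 coef e y} -> cproj A x = cproj A y.
Proof. by move=> xy; apply: eq_big_seq => j /xy ->. Qed.

Lemma cprojZ A a x : cproj A (a *: x) = a *: cproj A x.
Proof.
by rewrite /cproj scaler_sumr; apply: eq_bigr => j _; rewrite coefE scalerA.
Qed.

Lemma psum_cproj x n : psum e x n = cproj (iota 0 n) x.
Proof. by rewrite /psum /cproj /index_iota subn0. Qed.

Definition larger x i j : bool :=
  modulus (coef e x j) <= modulus (coef e x i).

Lemma larger_trans x : transitive (larger x).
Proof. by move=> j i k ij jk; exact: le_trans jk ij. Qed.

Lemma larger_total x : total (larger x).
Proof. by move=> i j; exact: le_total. Qed.

(** With ties allowed, several sets of the same size can be greedy. This freedom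
    is used for coefficients of constant modulus, where every subset of the
    support is greedy. *)
Definition greedy_set x A : Prop :=
  forall i j, i \in A -> j \notin A -> larger x i j.

Definition decreasing_support_list x L : Prop :=
  [/\ uniq L, forall j, (coef e x j != 0) = (j \in L) & pairwise (larger x) L].

Lemma decreasing_support_listD x y L A :
  decreasing_support_list x L -> decreasing_support_list y A ->
  (forall j, j \in A -> j \notin L) ->
  (forall i j, i \in L -> j \in A -> modulus (coef e y j) <= modulus (coef e x i)) ->
  decreasing_support_list (x + y) (L ++ A).
Proof.
move=> [uL sL pL] [uA sA pA] AL le_yx.
have LA j : j \in L -> j \notin A by apply: contraL => /AL.
have coefL j : j \in L -> coef e (x + y) j = coef e x j.
  by move=> /LA; rewrite -sA negbK coefE => /eqP ->; rewrite addr0.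
have coefA j : j \in A -> coef e (x + y) j = coef e y j.
  by move=> /AL; rewrite -sL negbK coefE => /eqP ->; rewrite add0r.
split.
- rewrite cat_uniq uL uA andbT /=; apply/hasPn => j; exact: AL.
- move=> j; rewrite mem_cat; have [jL|jL] := boolP (j \in L).
    by rewrite coefL // sL.
  by move: jL; rewrite -sL negbK coefE => /eqP ->; rewrite add0r sA.
- rewrite pairwise_cat; apply/and3P; split.
  + apply/allrelP => i j iL jA.
    by rewrite /larger (coefL i) // (coefA j) // le_yx.
  + apply: (sub_in_pairwise (P := mem L)) pL; last by apply/allP.
    by move=> i j iL jL; rewrite /larger !coefL.
  + apply: (sub_in_pairwise (P := mem A)) pA; last by apply/allP.
    by move=> i j iA jA; rewrite /larger !coefA.
Qed.

Section Hump.
Variable D : R.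
Hypothesis D_gt0 : 0 < D.
Hypothesis coef_le : forall x j, modulus (coef e x j) <= D * rnorm x.

Lemma rnorm_cproj_le A x : rnorm (cproj A x) <= (size A)%:R * D * rnorm x.
Proof.
elim: A => [|j A IH]; first by rewrite /cproj big_nil rnorm0 !mul0r.
rewrite /cproj big_cons; apply: le_trans (rnormD _ _) _.
rewrite [size _]/= -addn1 natrD addrC !mulrDl mul1r lerD //.
by rewrite rnormZ rnorm_basis // mulr1.
Qed.

(** If greedy projections are unbounded, they stay so on finitely supported
    vectors whose support avoids a given finite set L: truncating x to a long
    partial sum hardly changes its norm, and removing the coordinates in L
    changes a vector and its projections by at most a multiple of the norm of the
    vector. *)
Lemma exists_hump L (delta : R) : uniq L -> 0 < delta ->
  (forall M : R, exists x A,
     [/\ uniq A, greedy_set x A & M * rnorm x < rnorm (cproj A x)]) ->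
  exists x A B,
    [/\ decreasing_support_list x (A ++ B), (forall j, j \in A ++ B -> j \notin L),
        rnorm x <= delta & rnorm (cproj A x) = 1].
Proof.
move=> uL delta0 unbounded.
pose D' := (size L)%:R * D.
have D'0 : 0 <= D' by rewrite mulr_ge0 // ltW.
(* With this ratio, after losing [D'] in the numerator and a factor [1 + D'] in
   the denominator, the ratio is still [1 / delta]. *)
pose M := D' + (1 + D') / delta.
have [x [A [uA gA xA]]] := unbounded M.
have M0 : 0 <= M by rewrite addr_ge0 // divr_ge0 ?addr_ge0 // ltW.
pose eps := (rnorm (cproj A x) - M * rnorm x) / (M + 1).
have eps0 : 0 < eps by rewrite divr_gt0 ?subr_gt0 // ltr_wpDl.
have [n [An yn]] : exists n, {in A, forall j, (j < n)%N} /\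
    M * rnorm (psum e x n) < rnorm (cproj A x).
  have /cvg_rnormP /(_ _ eps0)[m _ hm] := cvg_psum e_basis x.
  exists (maxn m (\max_(j <- A) j).+1); split.
    by move=> j jA; rewrite leq_max ltnS (leq_bigmax_seq (F := id)) ?orbT.
  have := hm _ (leq_maxl m (\max_(j <- A) j).+1).
  move: (psum _ _ _) => y; rewrite /eps ltr_pdivlMr; last by rewrite ltr_wpDl.
  move=> h; have xy : rnorm y <= rnorm x + rnorm (x - y).
    by rewrite -[in leLHS](subKr x y) rnorm_sub_le.
  apply: le_lt_trans (ler_wpM2l M0 xy) _; move: h (rnorm_ge0 (x - y)).
  by rewrite (mulrDr _ M 1) (mulrDr M) mulr1 [M * rnorm (x - y)]mulrC => *; lra.
set y := psum e x n in yn.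
have coef_y j : coef e y j = if (j < n)%N then coef e x j else 0.
  by rewrite /y psum_cproj coef_cproj ?iota_uniq // mem_iota.
clearbody y; pose w := y - cproj L y.
have coef_w j : coef e w j =
    if (j < n)%N && (j \notin L) then coef e x j else 0.
  rewrite coefE coef_cproj // coef_y; case: (j \in L); rewrite ?andbT ?andbF ?subr0 //.
  by rewrite subrr.
pose A1 := [seq j <- A | (coef e x j != 0) && (j \notin L)].
pose B1 := [seq j <- iota 0 n |
  [&& coef e x j != 0, j \notin L & j \notin A]].
have w_le : rnorm w <= (1 + D') * rnorm y.
  apply: le_trans (rnorm_sub_le _ _) _.
  by rewrite mulrDl mul1r lerD2l rnorm_cproj_le.
have cprojA1 : cproj A1 w = cproj A x - cproj [seq j <- L | j \in A] y.
  apply: (coef_inj e_basis) => j.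
  rewrite coefE !coef_cproj ?filter_uniq // /A1 !mem_filter coef_w coef_y.
  have [jA|jA] := boolP (j \in A); last by rewrite !andbF subrr.
  rewrite (An _ jA) andbT /=; have [->|_] := eqVneq (coef e x j) 0.
    by rewrite !if_same subrr.
  by case: (j \in L); rewrite /= ?subrr ?subr0.
have cprojA1_ge : (1 + D') / delta * rnorm y < rnorm (cproj A1 w).
  have h : rnorm (cproj [seq j <- L | j \in A] y) <= D' * rnorm y.
    apply: le_trans (rnorm_cproj_le _ _) _.
    rewrite /D' ler_wpM2r ?rnorm_ge0 // (ler_wpM2r (ltW D_gt0)) // ler_nat.
    by rewrite size_filter count_size.
  have : rnorm (cproj A x) <=
      rnorm (cproj A1 w) + rnorm (cproj [seq j <- L | j \in A] y).
    by rewrite cprojA1; apply: le_trans (rnormD _ _); rewrite subrK.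
  by move: yn h; rewrite /M mulrDl; move: (_ / _ * _) => *; lra.
have p0 : 0 < rnorm (cproj A1 w).
  apply: le_lt_trans cprojA1_ge.
  by rewrite mulr_ge0 ?rnorm_ge0 // divr_ge0 ?addr_ge0 // ltW.
set t := rnorm (cproj A1 w) in cprojA1_ge p0.
have coef_tw j : coef e (of_real s t^-1 *: w) j = of_real s t^-1 * coef e w j.
  by rewrite coefE.
have tN0 : of_real s t^-1 != 0 by rewrite fmorph_eq0 invr_eq0 gt_eqF.
exists (of_real s t^-1 *: w), (sort (larger w) A1), (sort (larger w) B1).
have larger_tw : larger (of_real s t^-1 *: w) =2 larger w.
  move=> i j; rewrite /larger !coef_tw !modulusM ler_pM2l //.
  by rewrite lt_neqAle modulus_ge0 eq_sym modulus_eq0 tN0.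
have memAB j : (j \in sort (larger w) A1 ++ sort (larger w) B1) =
    [&& coef e x j != 0, j \notin L & (j < n)%N].
  rewrite mem_cat !mem_sort !mem_filter mem_iota /=.
  rewrite add0n; case: (_ != 0); case: (j \in L); rewrite //= ?andbT.
  by have [/An ->|_] := boolP (j \in A).
split.
- split.
  + rewrite cat_uniq !sort_uniq !filter_uniq ?iota_uniq // andbT /=.
    apply/hasPn => j; rewrite !mem_sort !mem_filter => /andP[/and3P[_ _ jA] _].
    by rewrite (negPf jA) andbF.
  + move=> j; rewrite memAB coef_tw mulf_eq0 negb_or tN0 /= coef_w.
    by case: ltnP; case: (j \in L); rewrite ?eqxx ?andbT ?andbF.
  + suff : pairwise (larger w) (sort (larger w) A1 ++ sort (larger w) B1).
      by apply: (sub_pairwise (r := larger w)) => i j; rewrite larger_tw.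
    rewrite pairwise_cat -!(sorted_pairwise (@larger_trans w)).
    rewrite !(sort_sorted (@larger_total w)) !andbT.
    apply/allrelP => i j; rewrite !mem_sort !mem_filter.
    move=> /andP[/andP[_ iL] iA] /andP[/and3P[_ jL jA]].
    rewrite mem_iota => /= jn.
    by rewrite /larger !coef_w iL jL jn (An _ iA); exact: gA.
- by move=> j; rewrite memAB => /and3P[].
- rewrite rnormZ_real gtr0_norm ?invr_gt0 // ler_pdivrMl //.
  apply: le_trans w_le _; move: cprojA1_ge.
  by rewrite mulrAC ltr_pdivrMr // => /ltW.
- rewrite (perm_cproj _ (permEl (perm_sort _ _))) cprojZ rnormZ_real -/t.
  by rewrite gtr0_norm ?invr_gt0 // mulVf ?gt_eqF.
Qed.

End Hump.
End Greedy.

(** * The gliding hump *)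

Lemma lim_of_prefixes (L : nat -> seq nat) :
  (forall k, exists A, L k.+1 = L k ++ A) -> (forall k, (k <= size (L k))%N) ->
  exists pi : nat -> nat,
    forall k n, (n <= size (L k))%N -> map pi (iota 0 n) = take n (L k).
Proof.
move=> Lpre Lsize.
have pre k m : (k <= m)%N -> exists A, L m = L k ++ A.
  elim: m => [|m IH]; first by rewrite leqn0 => /eqP ->; exists [::]; rewrite cats0.
  rewrite leq_eqVlt => /predU1P[->|]; first by exists [::]; rewrite cats0.
  rewrite ltnS => /IH[A LmE]; have [B ->] := Lpre m.
  by exists (A ++ B); rewrite LmE catA.
have nthL k m i : (i < size (L k))%N -> (i < size (L m))%N ->
    nth 0%N (L k) i = nth 0%N (L m) i.
  wlog km : k m / (k <= m)%N => [hw ik im|ik im].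
    by have [km|/ltnW mk] := leqP k m; [exact: hw|symmetry; exact: hw].
  by have [A ->] := pre _ _ km; rewrite nth_cat ik.
exists (fun i => nth 0%N (L i.+1) i) => k n nk.
apply: (@eq_from_nth _ 0%N) => [|i].
  by rewrite size_map size_iota size_takel.
rewrite size_map size_iota => lt_in.
rewrite (nth_map 0%N) ?size_iota // nth_iota // add0n nth_take //.
by apply: nthL; [exact: Lsize|exact: leq_trans nk].
Qed.

Section GlidingHump.
Context (R : realType) (s : scalar_kind) (X : completeNormedModType (scalars R s)).
Variable e : nat -> X.
Hypothesis e_basis : schauder_basis e.
Hypothesis e_normalized : forall j : nat, `|e j| = 1.
Implicit Types (x y z : X) (i j n : nat) (A B L : seq nat).

Lemma greedy_sum_cproj x pi n : greedy_sum e x pi n = cproj e (map pi (iota 0 n)) x.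
Proof. by rewrite /greedy_sum /cproj big_map /index_iota subn0. Qed.

Lemma coef_min_gt0 x L : decreasing_support_list e x L ->
  exists2 m : R, 0 < m & forall i, i \in L -> m <= modulus (coef e x i).
Proof.
move=> [_ sL _].
have : forall i, i \in L -> coef e x i != 0 by move=> i; rewrite sL.
elim: L {sL} => [|i L IH] hL; first by exists 1.
have [j jL|m m0 hm] := IH; first by apply: hL; rewrite inE jL orbT.
exists (Num.min m (modulus (coef e x i))).
  by rewrite lt_min m0 lt_neqAle modulus_ge0 eq_sym modulus_eq0 hL ?mem_head.
by move=> j; rewrite inE ge_min => /predU1P[->|/hm ->]; rewrite ?lexx ?orbT.
Qed.

Lemma greedy_ordering_of_prefixes x (L : nat -> seq nat) :
  (forall k, exists A, L k.+1 = L k ++ A) -> (forall k, (k <= size (L k))%N) ->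
  (forall k, uniq (L k)) -> (forall k, pairwise (larger e x) (L k)) ->
  (forall j, coef e x j != 0 -> exists k, j \in L k) ->
  exists2 pi, greedy_ordering e x pi &
    forall k n, (n <= size (L k))%N -> map pi (iota 0 n) = take n (L k).
Proof.
move=> Lpre Lsize uL pL sL; have [pi piL] := lim_of_prefixes Lpre Lsize.
have pi_nth k i : (i < size (L k))%N -> pi i = nth 0%N (L k) i.
  move=> ik; have := congr1 (fun l => nth 0%N l i) (piL k i.+1 ik).
  rewrite nth_take // (nth_map 0%N) ?size_iota // nth_iota // add0n.
exists pi => //; split.
- move=> i j; set k := (maxn i j).+1.
  have ik : (i < size (L k))%N by rewrite (leq_trans _ (Lsize k)) // ltnS leq_maxl.
  have jk : (j < size (L k))%N by rewrite (leq_trans _ (Lsize k)) // ltnS leq_maxr.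
  by rewrite (pi_nth k) // (pi_nth k) // => /eqP; rewrite nth_uniq // => /eqP.
- move=> j /sL[k jL]; exists (index j (L k)) => //.
  by rewrite (pi_nth k) ?index_mem // nth_index.
- move=> i; rewrite -le_modulus.
  have ik : (i.+1 < size (L i.+2))%N by exact: Lsize.
  rewrite (pi_nth i.+2) // (pi_nth i.+2) 1?ltnW //.
  by move/(pairwiseP 0%N): (pL i.+2); apply; rewrite ?inE // ltnW.
Qed.

(** The uniform bound behind quasi-greediness. The hump x_k is chosen after
    y_k = x_0 + ... + x_(k-1), away from the support of y_k and so small that its
    coefficients do not exceed the nonzero ones of y_k in modulus. The
    concatenation of the supports then lists the support of the sum z of all humps
    in decreasing order of modulus, and two greedy sums of z differ by the chosen
    projection of x_k, of norm 1. *)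
Theorem greedy_cproj_uniformly_bounded : quasi_greedy e -> exists K : R, forall x A,
  uniq A -> greedy_set e x A -> rnorm (cproj e A x) <= K * rnorm x.
Proof.
move=> e_quasi_greedy; apply: contrapT => bounded.
have [D D_gt0 coef_le] := coef_uniformly_bounded e_basis e_normalized.
have unbounded (M : R) : exists x A,
    [/\ uniq A, greedy_set e x A & M * rnorm x < rnorm (cproj e A x)].
  apply: contrapT => noM; apply: bounded; exists M => x A uA gA.
  by rewrite leNgt; apply/negP => xA; apply: noM; exists x, A.
have step (t : nat * (X * seq nat)) : exists t' : X * seq nat * seq nat,
    decreasing_support_list e t.2.1 t.2.2 ->
    [/\ decreasing_support_list e (t.2.1 + t'.1.1) (t.2.2 ++ (t'.1.2 ++ t'.2)),
        forall j, j \in t.2.2 -> coef e t'.1.1 j = 0,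
        rnorm t'.1.1 <= 2^-1 ^+ t.1 & rnorm (cproj e t'.1.2 t'.1.1) = 1].
  case: t => k [y L] /=; have [yL|nyL] := pselect (decreasing_support_list e y L);
    last first.
    by exists (0 : X, [::], [::]) => /nyL.
  have [m m0 hm] := coef_min_gt0 yL; have [uL _ _] := yL.
  (* Moduli of coefficients of a vector of norm [m / D] are at most [m], a
     positive lower bound for the nonzero moduli in [y]. *)
  pose delta := Num.min ((2^-1 : R) ^+ k) (m / D).
  have delta0 : 0 < delta by rewrite lt_min exprn_gt0 ?invr_gt0 // divr_gt0.
  have [x [A [B [xAB ABL xd xA]]]] :=
    exists_hump e_basis e_normalized D_gt0 coef_le uL delta0 unbounded.
  exists (x, A, B) => _ /=; split=> //.
  - apply: decreasing_support_listD => // i j iL _; apply: le_trans (hm i iL).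
    apply: le_trans (coef_le x j) _; rewrite mulrC -ler_pdivlMr //.
    by apply: le_trans xd _; rewrite ge_min lexx orbT.
  - move=> j jL; have [_ sAB _] := xAB; apply/eqP; rewrite -[_ == _]negbK sAB.
    by apply/negP => /ABL; rewrite jL.
  - by apply: le_trans xd _; rewrite ge_min lexx.
have [f fP] := choice step.
pose S := fix S k : X * seq nat := if k is k'.+1 then
  let t := f (k', S k') in ((S k').1 + t.1.1, (S k').2 ++ (t.1.2 ++ t.2))
  else (0, [::]).
pose y k := (S k).1; pose L k := (S k).2.
pose x k := (f (k, S k)).1.1; pose A k := (f (k, S k)).1.2.
pose B k := (f (k, S k)).2.
have yL k : decreasing_support_list e (y k) (L k).
  elim: k => [|k IH]; last by have [] := fP (k, S k) IH.
  by split=> // j; rewrite basis_coef0 // eqxx.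
have xP k : [/\ forall j, j \in L k -> coef e (x k) j = 0,
    rnorm (x k) <= 2^-1 ^+ k & rnorm (cproj e (A k) (x k)) = 1].
  by have [] := fP (k, S k) (yL k).
have yS k : y k.+1 = y k + x k by [].
have LS k : L k.+1 = L k ++ (A k ++ B k) by [].
have size_A_gt0 k : (0 < size (A k))%N.
  case E : (A k) => //; have [_ _] := xP k.
  rewrite E /cproj big_nil rnorm0 => /eqP.
  by rewrite eq_sym oner_eq0.
have Lsize k : (k <= size (L k))%N.
  elim: k => // k IH; rewrite LS !size_cat.
  by rewrite -addn1 leq_add // (leq_trans (size_A_gt0 k)) // leq_addr.
have subL k m j : (k <= m)%N -> j \in L k -> j \in L m.
  elim: m => [|m IH]; first by rewrite leqn0 => /eqP ->.
  rewrite leq_eqVlt => /predU1P[->//|]; rewrite ltnS => /IH {}IH /IH.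
  by rewrite LS mem_cat => ->.
have [z yz] : exists z : X, y @ \oo --> z.
  by apply: geometric_cvg => k; rewrite yS addrC addKr; have [] := xP k.
have coef_z k j : (forall m, (k <= m)%N -> coef e (y m) j = coef e (y k) j) ->
    coef e z j = coef e (y k) j.
  move=> ykm; apply/eqP; rewrite -subr_eq0 -modulus_eq0 eq_le modulus_ge0 andbT.
  apply/ler_addgt0Pr => eps eps0; rewrite add0r.
  have /cvg_rnormP /(_ _ (divr_gt0 eps0 D_gt0))[n _ hn] := yz.
  have := hn _ (leq_maxl n k); rewrite ltr_pdivlMr // mulrC => /ltW.
  by apply: le_trans; rewrite -(ykm _ (leq_maxr n k)) -basis_coefB.
have coef_zL k j : j \in L k -> coef e z j = coef e (y k) j.
  move=> jL; apply: coef_z; elim=> [|m IH]; first by rewrite leqn0 => /eqP ->.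
  rewrite leq_eqVlt => /predU1P[->//|]; rewrite ltnS => km.
  rewrite yS basis_coefD // IH //; have [-> //] := xP m; last exact: subL jL.
  by rewrite addr0.
have coef_z_neq0 j : coef e z j != 0 -> exists k, j \in L k.
  apply: contra_neqP => noL; have yk0 k : coef e (y k) j = 0.
    apply/eqP; rewrite -[_ == _]negbK; have [_ -> _] := yL k.
    by apply/negP => jL; apply: noL; exists k.
  by rewrite (coef_z 0%N) // => m _; rewrite !yk0.
have [|||pi zpi piL] := @greedy_ordering_of_prefixes z L _ Lsize _ _ coef_z_neq0.
- by move=> k; exists (A k ++ B k).
- by move=> k; have [] := yL k.
- move=> k; have [_ _] := yL k.
  apply: (sub_in_pairwise (P := mem (L k))); last by apply/allP.
  by move=> i j iL jL; rewrite /larger -!(coef_zL k).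
have /cvg_rnormP /(_ (2^-1))[|n _ hn] := e_quasi_greedy _ _ zpi.
  by rewrite invr_gt0.
have h1 := hn _ (Lsize n).
have h2 : rnorm (z - greedy_sum e z pi (size (L n ++ A n))) < 2^-1.
  by apply: hn => /=; rewrite size_cat (leq_trans (Lsize n)) ?leq_addr.
have : rnorm (greedy_sum e z pi (size (L n ++ A n)) -
              greedy_sum e z pi (size (L n))) = 1.
  rewrite !greedy_sum_cproj (piL n.+1); last by rewrite LS catA !size_cat leq_addr.
  rewrite (piL n) // LS catA take_size_cat // take_size cproj_cat addrC addKr.
  have [x0 _ <-] := xP n; congr rnorm; apply: eq_cproj => j jA.
  have jL : j \notin L n.
    have [+ _ _] := yL n.+1; rewrite LS cat_uniq => /and3P[_ /hasPn + _].
    by apply; rewrite mem_cat jA.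
  rewrite (coef_zL n.+1) ?LS ?mem_cat ?jA ?orbT // yS basis_coefD //.
  have [_ sL _] := yL n; move: jL; rewrite -sL negbK => /eqP ->.
  by rewrite add0r.
move/eqP; apply/negP; rewrite neq_lt; apply/orP; left.
rewrite -(subrKA z); apply: le_lt_trans (rnormD _ _) _.
rewrite rnorm_distC.
have -> : (1 : R) = 2^-1 + 2^-1 by lra.
exact: ltrD.
Qed.

End GlidingHump.

(** * Sums with bounded or monotone weights *)

Section Weights.
Context (R : realType) (s : scalar_kind) (X : completeNormedModType (scalars R s)).
Context (I : eqType) (v : I -> X).
Implicit Types (r : seq I) (w : X) (M beta : R).

(** A weighted sum with weights in [0, 1] is a convex combination of subset
    sums. The offset w is what makes the induction go through: one index at a
    time, it is either absorbed in w or dropped. *)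
Lemma rnorm_convex_le r (t : I -> R) w M :
  (forall i, i \in r -> 0 <= t i <= 1) ->
  (forall r', subseq r' r -> rnorm (w + \sum_(i <- r') v i) <= M) ->
  rnorm (w + \sum_(i <- r) of_real s (t i) *: v i) <= M.
Proof.
elim: r w => [|i r IH] w t01 wM.
  by have := wM [::] (sub0seq _); rewrite !big_nil.
have /andP[t0 t1] := t01 i (mem_head _ _).
have t01' j : j \in r -> 0 <= t j <= 1 by move=> jr; rewrite t01 // inE jr orbT.
have h1 : rnorm ((w + v i) + \sum_(j <- r) of_real s (t j) *: v j) <= M.
  apply: IH => // r' r'r; have := wM (i :: r').
  by rewrite big_cons addrA; apply; rewrite /= eqxx.
have h0 : rnorm (w + \sum_(j <- r) of_real s (t j) *: v j) <= M.
  apply: IH => // r' r'r; apply: wM.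
  exact: subseq_trans r'r (subseq_cons _ _).
rewrite big_cons; move: (\sum_(j <- r) _) h0 h1 => S h0 h1.
have -> : w + (of_real s (t i) *: v i + S) =
    of_real s (t i) *: (w + v i + S) + of_real s (1 - t i) *: (w + S).
  rewrite addrCA [w + v i + S]addrAC [w + S + v i]addrC scalerDr -addrA.
  by congr (_ + _); rewrite rmorphB rmorph1 scalerBl scale1r [RHS]addrC subrK.
apply: le_trans (rnormD _ _) _; rewrite !rnormZ_real !ger0_norm ?subr_ge0 //.
have -> : M = t i * M + (1 - t i) * M by ring.
by rewrite lerD // ler_wpM2l // subr_ge0.
Qed.

Lemma rnorm_nonneg_weights_le r (t : I -> R) beta M : 0 <= beta ->
  (forall i, i \in r -> 0 <= t i <= beta) ->
  (forall r', subseq r' r -> rnorm (\sum_(i <- r') v i) <= M) ->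
  rnorm (\sum_(i <- r) of_real s (t i) *: v i) <= beta * M.
Proof.
move=> b_ge0 tb rM; have [b0|b0] := eqVneq beta 0.
  rewrite big_seq big1 ?rnorm0 ?b0 ?mul0r // => i /tb.
  by rewrite b0 -eq_le => /eqP <-; rewrite rmorph0 scale0r.
have b_gt0 : 0 < beta by rewrite lt_neqAle eq_sym b0.
have -> : \sum_(i <- r) of_real s (t i) *: v i =
    of_real s beta *: (0 + \sum_(i <- r) of_real s (t i / beta) *: v i).
  rewrite add0r scaler_sumr; apply: eq_bigr => i _.
  by rewrite scalerA -rmorphM mulrC divfK.
rewrite rnormZ_real gtr0_norm // ler_pM2l //.
apply: rnorm_convex_le => [i /tb /andP[t0 t1]|r' /rM]; last by rewrite add0r.
by rewrite divr_ge0 //= ler_pdivrMr // mul1r.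
Qed.

Lemma rnorm_real_weights_le r (t : I -> R) beta M : 0 <= beta ->
  (forall i, i \in r -> `|t i| <= beta) ->
  (forall r', subseq r' r -> rnorm (\sum_(i <- r') v i) <= M) ->
  rnorm (\sum_(i <- r) of_real s (t i) *: v i) <= 2 * beta * M.
Proof.
move=> b_ge0 tb rM.
have -> : \sum_(i <- r) of_real s (t i) *: v i =
    \sum_(i <- r) of_real s (Num.max (t i) 0) *: v i -
    \sum_(i <- r) of_real s (Num.max (- t i) 0) *: v i.
  rewrite -sumrB; apply: eq_bigr => i _; rewrite -scalerBl -rmorphB; congr (_ *: _).
  by congr (of_real s _); case: (lerP (t i) 0); case: (lerP (- t i) 0); lra.
apply: le_trans (rnorm_sub_le _ _) _; rewrite -mulrA mulr_natl mulr2n.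
by apply: lerD; apply: rnorm_nonneg_weights_le => // i /tb;
  rewrite ler_norml le_max lexx orbT ge_max b_ge0 andbT /= => /andP[]; lra.
Qed.

Lemma rnorm_weights_le r (b : I -> scalars R s) beta M : 0 <= beta ->
  (forall i, i \in r -> modulus (b i) <= beta) ->
  (forall r', subseq r' r -> rnorm (\sum_(i <- r') v i) <= M) ->
  rnorm (\sum_(i <- r) b i *: v i) <= 4 * beta * M.
Proof.
move=> b_ge0 bb rM.
have [u [re [im [u1 reimE _ reim_le]]]] := scalar_parts R s.
have -> : \sum_(i <- r) b i *: v i =
    \sum_(i <- r) of_real s (re (b i)) *: v i +
    u *: \sum_(i <- r) of_real s (im (b i)) *: v i.
  rewrite scaler_sumr -big_split; apply: eq_bigr => i _.
  by rewrite /= scalerA -scalerDl -reimE.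
apply: le_trans (rnormD _ _) _.
have -> : 4 * beta * M = 2 * beta * M + 2 * beta * M by ring.
apply: lerD.
  by apply: rnorm_real_weights_le => // i /bb; exact: le_trans (reim_le _).1.
rewrite rnormZ; apply: le_trans (ler_piMl (rnorm_ge0 _) u1) _.
by apply: rnorm_real_weights_le => // i /bb; exact: le_trans (reim_le _).2.
Qed.

(** Summation by parts: a sum with decreasing nonnegative weights is a positive
    combination of its initial segments, with total weight the largest one. *)
Lemma rnorm_monotone_weights_le r (t : I -> R) w (t0 : R) M :
  path >=%R t0 [seq t i | i <- r] -> 0 <= t0 -> (forall i, i \in r -> 0 <= t i) ->
  (forall n, rnorm (w + \sum_(i <- take n r) v i) <= M) ->
  rnorm (of_real s t0 *: w + \sum_(i <- r) of_real s (t i) *: v i) <= t0 * M.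
Proof.
elim: r w t0 => [|i r IH] w t0 /=.
  move=> _ t00 _ /(_ 0%N); rewrite !big_nil !addr0 => wM.
  by rewrite rnormZ_real ger0_norm // ler_wpM2l.
move=> /andP[tit0 pr] t00 t_ge0 wM.
have ti0 := t_ge0 i (mem_head _ _).
have wM0 : rnorm w <= M by have := wM 0%N; rewrite big_nil addr0.
have h : rnorm (of_real s (t i) *: (w + v i) +
    \sum_(j <- r) of_real s (t j) *: v j) <= t i * M.
  apply: IH => // [j jr|n]; first by rewrite t_ge0 // inE jr orbT.
  by have := wM n.+1; rewrite /= big_cons addrA.
rewrite big_cons.
have -> : of_real s t0 *: w + (of_real s (t i) *: v i +
      \sum_(j <- r) of_real s (t j) *: v j) =
    of_real s (t0 - t i) *: w + (of_real s (t i) *: (w + v i) +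
      \sum_(j <- r) of_real s (t j) *: v j).
  by rewrite rmorphB scalerBl scalerDr !addrA subrK.
apply: le_trans (rnormD _ _) _; rewrite rnormZ_real ger0_norm ?subr_ge0 //.
have -> : t0 * M = (t0 - t i) * M + t i * M by ring.
by rewrite lerD // ler_wpM2l ?subr_ge0.
Qed.

End Weights.

(** * Democracy functions *)

Section Democracy.
Context (R : realType) (s : scalar_kind) (X : completeNormedModType (scalars R s)).
Variable e : nat -> X.
Hypothesis e_basis : schauder_basis e.
Hypothesis e_normalized : forall j : nat, `|e j| = 1.
Implicit Types (x y z : X) (i j n : nat) (A B L : seq nat).

Lemma indicator_normsP A : uniq A ->
  indicator_norms e (size A) (rnorm (\sum_(j <- A) e j)).
Proof.
move=> uA; exists [fset j in A]%fset; last first.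
  congr rnorm; apply: perm_big; apply: uniq_perm; rewrite ?fset_uniq // => j.
  by rewrite in_fset.
rewrite /= card_fseq undup_id //.
Qed.

Lemma indicator_norms_bounded n r : indicator_norms e n r -> 0 <= r <= n%:R.
Proof.
move=> [A <- <-]; rewrite rnorm_ge0 /=.
apply: le_trans (rnorm_sum _ _ _) _.
under eq_bigr do rewrite rnorm_basis //.
by rewrite big_const_seq count_predT iter_addr addr0.
Qed.

Lemma indicator_norms_neq0 n : indicator_norms e n !=set0.
Proof.
exists (rnorm (\sum_(j <- iota 0 n) e j)).
rewrite -[n in indicator_norms _ n](size_iota 0).
exact: indicator_normsP (iota_uniq _ _).
Qed.

Lemma rnorm_indicator_le_h_r A : uniq A -> rnorm (\sum_(j <- A) e j) <= h_r e (size A).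
Proof.
move=> uA; apply: sup_upper_bound; last exact: indicator_normsP.
split; first exact: indicator_norms_neq0.
by exists (size A)%:R => r /indicator_norms_bounded /andP[].
Qed.

Lemma h_l_le_rnorm_indicator A : uniq A -> h_l e (size A) <= rnorm (\sum_(j <- A) e j).
Proof.
move=> uA; apply: inf_lbound; last exact: indicator_normsP.
by exists 0 => r /indicator_norms_bounded /andP[].
Qed.

Lemma h_r_ge0 n : 0 <= h_r e n.
Proof.
rewrite -(size_iota 0 n).
exact: le_trans (rnorm_ge0 _) (rnorm_indicator_le_h_r (iota_uniq 0 n)).
Qed.

Lemma coef_sum_indicator A j : uniq A ->
  coef e (\sum_(i <- A) e i) j = (j \in A)%:R.
Proof.
move=> uA; rewrite -(eq_bigr _ (fun i _ => scale1r (e i))).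
by rewrite (coef_sum_basis e_basis) //; case: (j \in A).
Qed.

Lemma h_l_gt0 n : (0 < n)%N -> 0 < h_l e n.
Proof.
move=> n0; have [D D0 coef_le] := coef_uniformly_bounded e_basis e_normalized.
apply: (@lt_le_trans _ _ D^-1); first by rewrite invr_gt0.
(* A coefficient functional of norm at most D takes the value 1. *)
apply: lb_le_inf; first exact: indicator_norms_neq0.
move=> _ [A sA <-]; rewrite -[D^-1]mul1r ler_pdivrMr // mulrC.
have [j jA] : exists j, j \in A by apply/fset0Pn; rewrite -cardfs_gt0 sA.
have := coef_le (\sum_(j <- A) e j) j.
by rewrite coef_sum_indicator ?fset_uniq // jA modulus1.
Qed.

Lemma exists_superset n A : uniq A -> (size A <= n)%N ->
  exists A', [/\ uniq A', size A' = n & {subset A <= A'}].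
Proof.
move=> uA An; exists (A ++ iota (\max_(j <- A) j).+1 (n - size A)); split.
- rewrite cat_uniq uA iota_uniq andbT; apply/hasPn => j.
  rewrite mem_iota => /andP[jA _]; apply/negP => /= jinA.
  by move: jA; rewrite ltnNge (leq_bigmax_seq (F := id)).
- by rewrite size_cat size_iota subnKC.
- by move=> j; rewrite mem_cat => ->.
Qed.

(** * Consequences of the greedy bound *)

Variable K : R.
Hypothesis greedy_le : forall x A,
  uniq A -> greedy_set e x A -> rnorm (cproj e A x) <= K * rnorm x.

(** Every subset A' of A is a greedy set of a vector whose coefficients have
    constant modulus on A and vanish elsewhere, so subset sums are bounded by the
    greedy bound; weights follow by convexity. *)
Lemma rnorm_flat_weights_le A (c b : nat -> scalars R s) (m beta : R) :
  uniq A -> 0 <= beta ->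
  (forall j, j \in A -> modulus (c j) = m) ->
  (forall j, j \in A -> modulus (b j) <= beta) ->
  rnorm (\sum_(j <- A) b j *: (c j *: e j)) <=
    4 * beta * (K * rnorm (\sum_(j <- A) c j *: e j)).
Proof.
move=> uA b0 cm bb; apply: rnorm_weights_le => // A' A'A.
have uA' := subseq_uniq A'A uA.
set x := \sum_(j <- A) c j *: e j.
have cx j : coef e x j = if j \in A then c j else 0 by rewrite coef_sum_basis.
have -> : \sum_(j <- A') c j *: e j = cproj e A' x.
  by apply: eq_big_seq => j /(mem_subseq A'A) jA; rewrite cx jA.
apply: greedy_le => // i j /(mem_subseq A'A) iA _.
rewrite /larger !cx iA (cm i iA); case: ifP => [/cm -> //|_].
by rewrite modulus0 -(cm i iA) modulus_ge0.
Qed.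

Hypothesis K_ge0 : 0 <= K.

Lemma rnorm_le_h_r A (b : nat -> scalars R s) beta n :
  uniq A -> (size A <= n)%N -> 0 <= beta ->
  (forall j, j \in A -> modulus (b j) <= beta) ->
  rnorm (\sum_(j <- A) b j *: e j) <= 4 * beta * (K * h_r e n).
Proof.
move=> uA An b0 bb; have [A' [uA' <- AA']] := exists_superset uA An.
pose b' j := if j \in A then b j else 0.
have -> : \sum_(j <- A) b j *: e j = \sum_(j <- A') b' j *: ((1 : scalars R s) *: e j).
  apply: (coef_inj e_basis) => j; under [in RHS]eq_bigr do rewrite scale1r.
  rewrite !coef_sum_basis // /b'; case: ifPn => [/AA' -> //|_].
  by rewrite if_same.
apply: le_trans (rnorm_flat_weights_le (m := 1) (beta := beta) uA' b0 _ _) _.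
- by move=> j _; rewrite modulus1.
- by move=> j _; rewrite /b'; case: ifP => [/bb//|_]; rewrite modulus0.
- under eq_bigr do rewrite scale1r.
  by rewrite ler_wpM2l ?mulr_ge0 // ler_wpM2l // rnorm_indicator_le_h_r.
Qed.

(** Order A by increasing modulus of the coefficients of z; then the weights
    decrease and are at most 1. Final segments in this order are greedy sets of z,
    so initial segments, differences of two greedy sets, have projections bounded
    by 2 K. *)
Lemma rnorm_truncation_le z A (alpha : R) : uniq A -> greedy_set e z A ->
  0 < alpha -> (forall j, j \in A -> alpha <= modulus (coef e z j)) ->
  rnorm (\sum_(j <- A)
    of_real s (alpha / modulus (coef e z j)) *: (coef e z j *: e j))
    <= 2 * K * rnorm z.
Proof.
move=> uA gA a0 Aa; pose asc i j := larger e z j i.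
have asc_trans : transitive asc by move=> j i k ij jk; exact: le_trans ij jk.
have asc_total : total asc by move=> i j; exact: le_total.
pose L := sort asc A.
have LA : perm_eq L A by rewrite perm_sort.
have memL j : (j \in L) = (j \in A) by rewrite mem_sort.
have pL : pairwise asc L by rewrite -sorted_pairwise // sort_sorted.
have uL : uniq L by rewrite sort_uniq.
rewrite -(perm_big _ LA) /=.
have mz0 j : j \in L -> 0 < modulus (coef e z j).
  by rewrite memL => /Aa; exact: lt_le_trans.
pose t j : R := alpha / modulus (coef e z j).
have := @rnorm_monotone_weights_le R s X _ (fun j => coef e z j *: e j)
  L t 0 1 (2 * K * rnorm z).
rewrite scaler0 add0r mul1r; apply=> //.
- rewrite -[path _ _ _]/(sorted >=%R (1 :: [seq t j | j <- L])).
  rewrite sorted_pairwise; last by move=> ? ? ? h1 h2; exact: le_trans h2 h1.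
  rewrite /= pairwise_map; apply/andP; split.
    apply/allP => _ /mapP[j jL ->].
    by rewrite /= ler_pdivrMr ?mz0 // mul1r Aa // -memL.
  apply: (sub_in_pairwise (P := mem L)) pL; last by apply/allP.
  by move=> i j iL jL ij; rewrite /= ler_pM2l // lef_pV2 ?posrE ?mz0.
- by move=> j jL; rewrite divr_ge0 ?ltW // mz0.
- move=> n; rewrite add0r -/(cproj e (take n L) z).
  have -> : cproj e (take n L) z = cproj e A z - cproj e (drop n L) z.
    by rewrite -(perm_cproj e z LA) -{2}(cat_take_drop n L) cproj_cat addrK.
  apply: le_trans (rnorm_sub_le _ _) _; rewrite -mulrA mulr_natl mulr2n lerD //.
    exact: greedy_le.
  apply: greedy_le; first exact: drop_uniq.
  move=> i j idrop jdrop.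
  have [jA|jA] := boolP (j \in A); last first.
    by apply: gA => //; rewrite -memL (mem_drop idrop).
  move: jA pL; rewrite -memL -{1 2}(cat_take_drop n L) mem_cat (negPf jdrop) orbF.
  by rewrite pairwise_cat => jtake /andP[/allrelP /(_ _ _ jtake idrop)].
Qed.

(** Weights of modulus 1 / alpha carry the truncation of z, whose coefficients
    have modulus alpha, to the sum of the basis vectors over n elements of A. *)
Lemma h_l_le_of_greedy_set z A (alpha : R) n : uniq A -> greedy_set e z A ->
  (n <= size A)%N -> 0 <= alpha ->
  (forall j, j \in A -> alpha <= modulus (coef e z j)) ->
  alpha * h_l e n <= 8 * K ^+ 2 * rnorm z.
Proof.
move=> uA gA nA; rewrite le_eqVlt => /predU1P[<- _|a0 Aa].
  by rewrite mul0r !mulr_ge0 ?exprn_ge0 ?rnorm_ge0.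
pose B := take n A.
have BA j : j \in B -> j \in A by exact: mem_take.
have uB : uniq B by exact: take_uniq.
have mz0 j : j \in A -> 0 < modulus (coef e z j) by move/Aa; exact: lt_le_trans.
have z0 j : j \in A -> coef e z j != 0.
  by move/mz0; rewrite lt_neqAle eq_sym modulus_eq0 => /andP[].
have am0 j : j \in A -> alpha / modulus (coef e z j) != 0.
  by move=> jA; rewrite mulf_neq0 ?invr_eq0 ?gt_eqF // mz0.
pose c j := of_real s (alpha / modulus (coef e z j)) * coef e z j.
have mc j : j \in A -> modulus (c j) = alpha.
  move=> jA; rewrite modulusM modulus_of_real ger0_norm ?divfK ?gt_eqF ?mz0 //.
  by rewrite divr_ge0 ?ltW // mz0.
have c0 j : j \in A -> c j != 0.
  by move=> /mc; rewrite -modulus_eq0 => ->; rewrite gt_eqF.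
pose b j := if j \in B then (c j)^-1 else 0.
have indicatorE : \sum_(j <- B) e j = \sum_(j <- A) b j *: (c j *: e j).
  apply: (coef_inj e_basis) => j; rewrite coef_sum_indicator //.
  under eq_bigr do rewrite scalerA.
  rewrite coef_sum_basis // /b; have [jB|_] := boolP (j \in B).
    by rewrite BA // mulVf // c0 // BA.
  by rewrite mul0r if_same.
rewrite mulrC -ler_pdivlMr //.
have -> : n = size B by rewrite size_takel.
apply: le_trans (h_l_le_rnorm_indicator uB) _; rewrite indicatorE.
apply: le_trans (rnorm_flat_weights_le (m := alpha) (beta := alpha^-1) uA _ mc _) _.
- by rewrite invr_ge0 ltW.
- move=> j jA; rewrite /b; case: ifP => _; last by rewrite modulus0 invr_ge0 ltW.
  by rewrite modulusV mc.
have -> : 8 * K ^+ 2 * rnorm z / alpha =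
    4 * alpha^-1 * (K * (2 * K * rnorm z)) by ring.
rewrite ler_wpM2l ?mulr_ge0 ?invr_ge0 ?(ltW a0) // ler_wpM2l //.
under eq_bigr do rewrite /c -scalerA.
exact: rnorm_truncation_le.
Qed.

(** The constants: P_G z contributes K, and the two terms with coefficients at
    most alpha contribute 4 K alpha h_r(N) each, where
    alpha <= 8 K^2 |z| / h_l(k). *)
Lemma greedy_error_le x y L B (alpha : R) N k :
  uniq L -> size L = (N + k)%N -> 0 <= alpha ->
  (forall j, j \in L -> alpha <= modulus (coef e x j)) ->
  (forall j, j \notin L -> modulus (coef e x j) <= alpha) ->
  uniq B -> (size B <= N)%N -> (forall j, j \notin B -> coef e y j = 0) ->
  (0 < k)%N ->
  rnorm (x - cproj e L x) <=
    (1 + K + 64 * K ^+ 3) * (1 + h_r e N / h_l e k) * rnorm (x - y).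
Proof.
move=> uL sL a0 La Lca uB BN By k0.
set z := x - y.
have cz j : coef e z j = coef e x j - coef e y j by rewrite basis_coefB.
clearbody z.
have czB j : j \notin B -> coef e z j = coef e x j.
  by move=> /By yj; rewrite cz yj subr0.
pose big j := alpha <= modulus (coef e z j).
pose G := [seq j <- L | j \notin B] ++ [seq j <- B | big j].
have uG : uniq G.
  rewrite cat_uniq !filter_uniq // andbT; apply/hasPn => j.
  by rewrite !mem_filter => /andP[_ ->].
have Ga j : j \in G -> alpha <= modulus (coef e z j).
  rewrite mem_cat !mem_filter => /orP[/andP[jB jL]|/andP[]//].
  by rewrite czB // La.
have gG : greedy_set e z G.
  move=> i j /Ga iG; rewrite mem_cat !mem_filter negb_or !negb_and negbK.
  move=> /andP[jL jB]; apply: le_trans iG.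
  have [jinB|jnB] := boolP (j \in B).
    by move: jB; rewrite jinB orbF /big -ltNge => /ltW.
  by move: jL; rewrite (negPf jnB) /= czB //; exact: Lca.
have kG : (k <= size G)%N.
  rewrite size_cat (leq_trans _ (leq_addr _ _)) // size_filter.
  have := count_predC (mem B) L; rewrite sL -(leq_add2l N) => <-.
  rewrite leq_add2r -size_filter (leq_trans _ BN) // uniq_leq_size ?filter_uniq //.
  by move=> j; rewrite mem_filter => /andP[].
have decomposition : x - cproj e L x = z - cproj e G z
    - cproj e [seq j <- B | ~~ big j] z + cproj e [seq j <- B | j \notin L] x.
  apply: (coef_inj e_basis) => j.
  rewrite !(basis_coefB e_basis, basis_coefD e_basis) !coef_cproj ?filter_uniq //.
  rewrite mem_cat !mem_filter.
  have [jB|jB] := boolP (j \in B).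
    case: (big j); case: (j \in L); rewrite /= ?subr0 ?addr0 ?subrr ?add0r //.
  by rewrite czB // !andbF orbF subr0 addr0.
have hl0 := h_l_gt0 k0; have hr0 := h_r_ge0 N.
have a_le : alpha <= 8 * K ^+ 2 * rnorm z / h_l e k.
  by rewrite ler_pdivlMr //; exact: (h_l_le_of_greedy_set uG).
have small1 : rnorm (cproj e [seq j <- B | ~~ big j] z) <= 4 * alpha * (K * h_r e N).
  apply: rnorm_le_h_r; rewrite ?filter_uniq //.
    by rewrite size_filter (leq_trans (count_size _ _)).
  by move=> j; rewrite mem_filter -ltNge => /andP[/ltW].
have small2 : rnorm (cproj e [seq j <- B | j \notin L] x) <= 4 * alpha * (K * h_r e N).
  apply: rnorm_le_h_r; rewrite ?filter_uniq //.
    by rewrite size_filter (leq_trans (count_size _ _)).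
  by move=> j; rewrite mem_filter => /andP[/Lca].
rewrite decomposition.
apply: le_trans (rnormD _ _) _.
apply: le_trans (lerD (rnorm_sub_le _ _) small2) _.
apply: le_trans (lerD (lerD (rnorm_sub_le _ _) small1) (lexx _)) _.
have gz := greedy_le uG gG.
have a_le' : 4 * alpha * (K * h_r e N) <=
    32 * K ^+ 3 * (h_r e N / h_l e k) * rnorm z.
  have -> : 32 * K ^+ 3 * (h_r e N / h_l e k) * rnorm z =
      4 * (8 * K ^+ 2 * rnorm z / h_l e k) * (K * h_r e N) by ring.
  by rewrite ler_wpM2r ?mulr_ge0 // ler_wpM2l.
set q := h_r e N / h_l e k in a_le' *.
have q0 : 0 <= q by rewrite divr_ge0 // ltW.
have : 0 <= 64 * K ^+ 3 * rnorm z + (1 + K) * q * rnorm z.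
  by do ?[exact: q0 | exact: rnorm_ge0 | exact: K_ge0
    | apply: addr_ge0 | apply: mulr_ge0 | apply: exprn_ge0].
have -> : (1 + K + 64 * K ^+ 3) * (1 + q) * rnorm z =
  rnorm z + K * rnorm z + 2 * (32 * K ^+ 3 * q * rnorm z) +
  (64 * K ^+ 3 * rnorm z + (1 + K) * q * rnorm z) by ring.
move: gz a_le'; move: (rnorm _) (_ * q * _) => *; lra.
Qed.

End Democracy.

(** * The Lebesgue-type inequality *)

Section Orderings.
Context (R : realType) (s : scalar_kind) (X : completeNormedModType (scalars R s)).
Variable e : nat -> X.
Hypothesis e_basis : schauder_basis e.
Implicit Types (x y : X) (pi : nat -> nat).

Lemma greedy_ordering_le x pi i j : greedy_ordering e x pi -> (i <= j)%N ->
  modulus (coef e x (pi j)) <= modulus (coef e x (pi i)).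
Proof.
move=> [_ _ dec]; elim: j => [|j IH]; first by rewrite leqn0 => /eqP ->.
rewrite leq_eqVlt => /predU1P[->//|]; rewrite ltnS => /IH; apply: le_trans.
by rewrite le_modulus.
Qed.

Lemma greedy_ordering_prefix x pi n : greedy_ordering e x pi -> (0 < n)%N ->
  let L := [seq pi i | i <- iota 0 n] in
  exists2 alpha : R, 0 <= alpha & [/\ uniq L,
    forall j, j \in L -> alpha <= modulus (coef e x j) &
    forall j, j \notin L -> modulus (coef e x j) <= alpha].
Proof.
move=> xpi n0; have [pi_inj pi_supp _] := xpi.
exists (modulus (coef e x (pi n.-1))); first exact: modulus_ge0.
split; first by rewrite map_inj_uniq ?iota_uniq.
  move=> _ /mapP[i + ->]; rewrite mem_iota add0n => /= lt_in.
  by apply: greedy_ordering_le xpi _; rewrite -ltnS prednK.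
move=> j jL; have [->|xj] := eqVneq (coef e x j) 0.
  by rewrite modulus0 modulus_ge0.
have [i _ ij] := pi_supp j xj; rewrite -ij; apply: greedy_ordering_le xpi _.
rewrite leqNgt; apply: contra jL => lt_in.
by rewrite -ij map_f // mem_iota add0n /= (leq_trans lt_in) // leq_pred.
Qed.

Lemma SigmaP N y : Sigma e N y -> exists B,
  [/\ uniq B, (size B <= N)%N & forall j, j \notin B -> coef e y j = 0].
Proof.
move=> yN; have fin : finite_set [set j | coef e y j != 0].
  by apply/finite_set_leP; exists N.
exists (fset_set [set j | coef e y j != 0%R]); split.
- exact: fset_uniq.
- exact: geq_card_fset_set.
- move=> j; rewrite in_fset_set // notin_setE /= => /negP.
  by rewrite negbK => /eqP.
Qed.

Lemma Sigma0 N : Sigma e N 0.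
Proof.
rewrite /Sigma /=; have -> : [set j | coef e (0 : X) j != 0] = set0.
  by apply/seteqP; split=> j //=; rewrite basis_coef0 // eqxx.
exact: card_ge0.
Qed.

End Orderings.

Theorem theorem1p3 (R : realType) (s : scalar_kind)
    (X : completeNormedModType (scalars R s)) (e : nat -> X)
    (e_basis : schauder_basis e)
    (e_normalized : forall j : nat, `|e j| = 1)
    (e_quasi_greedy : quasi_greedy e) :
  exists2 c : R, 0 < c &
    forall N k : nat, (0 < N)%N -> (0 < k)%N ->
    forall (x : X) (pi : nat -> nat), greedy_ordering e x pi ->
      rnorm (x - greedy_sum e x pi (N + k))
        <= c * (1 + h_r e N / h_l e k) * sigma e N x.
Proof.
have [K0 greedy_le0] := greedy_cproj_uniformly_bounded
  e_basis e_normalized e_quasi_greedy.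
pose K := `|K0|; have K_ge0 : 0 <= K by exact: normr_ge0.
have greedy_le x A : uniq A -> greedy_set e x A ->
    rnorm (cproj e A x) <= K * rnorm x.
  move=> uA gA; apply: le_trans (greedy_le0 x A uA gA) _.
  by rewrite ler_wpM2r ?rnorm_ge0 ?ler_norm.
exists (1 + K + 64 * K ^+ 3).
  by rewrite -addrA ltr_pwDl // addr_ge0 // mulr_ge0 ?exprn_ge0.
move=> N k N0 k0 x pi xpi; set c := _ * (1 + _).
have c0 : 0 < c.
  rewrite mulr_gt0 //.
    by rewrite -addrA ltr_pwDl // addr_ge0 // mulr_ge0 ?exprn_ge0.
  by rewrite ltr_pwDl // divr_ge0 ?h_r_ge0 ?(ltW (h_l_gt0 _ _ k0)).
rewrite mulrC -ler_pdivrMr //; apply: lb_le_inf.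
  by exists (rnorm (x - 0)), 0 => //; exact: Sigma0.
move=> _ [y /SigmaP[B [uB BN By]] <-]; rewrite ler_pdivrMr // mulrC.
have [|alpha a0 [uL La Lca]] := greedy_ordering_prefix (n := N + k) xpi.
  by rewrite addn_gt0 N0.
rewrite greedy_sum_cproj.
apply: (greedy_error_le e_basis e_normalized greedy_le K_ge0
  uL _ a0 La Lca uB BN By k0).
by rewrite size_map size_iota.
Qed.
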